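(* The poset $\tilde{\mathcal{P}}_k$ is universal for every $k\geq 2$, and the poset $\tilde{\mathcal{L}}_k$ is universal for every $k\geq 3$.
   Context: A $k$-poset is an object $(P;\leq,c)$ where $(P;\leq)$ is a partially ordered set and $c\colon P\to\{0,1,\dots,k-1\}$ is a labeling function. A $k$-lattice is a $k$-poset whose underlying poset is a lattice. A homomorphism of $k$-posets is a map that preserves order ($x\leq y$ implies $h(x)\leq h(y)$) and labels. $\mathcal{P}_k$ and $\mathcal{L}_k$ denote the classes of all finite $k$-posets and all finite $k$-lattices, respectively. The homomorphism quasiorder is defined by $(P,c)\leq(P',c')$ if and only if there is a homomorphism of $(P,c)$ to $(P',c')$; $\equiv$ is the induced equivalence relation; $\tilde{\mathcal{P}}_k=\mathcal{P}_k/{\equiv}$ and $\tilde{\mathcal{L}}_k=\mathcal{L}_k/{\equiv}$ carry the partial order induced by $\leq$. A countable poset is universal if every countable poset can be embedded into it (an embedding is a map $f$ with $x\leq y\iff f(x)\leq f(y)$). *)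

(* Defs.v *)
From HB Require Import structures.
From mathcomp Require Import all_boot all_order.
From mathcomp Require Import boolp classical_sets functions cardinality.

Set Implicit Arguments.
Unset Strict Implicit.
Unset Printing Implicit Defensive.

Import Order.TTheory.
Local Open Scope order_scope.
Local Open Scope quotient_scope.

Section PosetQuotient.
Context {d : Order.disp_t} (T : preorderType d).

Definition order_equiv : rel T := [rel x y | (x <= y) && (y <= x)].

Lemma order_equiv_refl : reflexive order_equiv.
Proof. by move=> x; rewrite /order_equiv /= lexx. Qed.

Lemma order_equiv_sym : symmetric order_equiv.
Proof. by move=> x y; rewrite /order_equiv /= andbC. Qed.

Lemma order_equiv_trans : transitive order_equiv.
Proof.
move=> y x z /andP[xy yx] /andP[yz zy].
by apply/andP; split; [exact: le_trans xy yz | exact: le_trans zy yx].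
Qed.

Canonical order_equiv_rel :=
  EquivRel order_equiv order_equiv_refl order_equiv_sym order_equiv_trans.

Definition poset_quot : Type := {eq_quot order_equiv_rel}.
HB.instance Definition _ := Choice.on poset_quot.
HB.instance Definition _ := EqQuotient.on poset_quot.

(* Comparing the chosen representatives is independent of the choice, see
   [le_pi] below. *)
Definition poset_quot_le : rel poset_quot := [rel C D | repr C <= repr D].

Lemma poset_quot_le_refl : reflexive poset_quot_le.
Proof. by move=> C; rewrite /poset_quot_le /= lexx. Qed.

Lemma poset_quot_le_anti : antisymmetric poset_quot_le.
Proof.
move=> C D CD; rewrite -[C]reprK -[D]reprK.
by apply/eqP; rewrite eqquotE.
Qed.

Lemma poset_quot_le_trans : transitive poset_quot_le.
Proof. move=> D C E CD DE; exact: (le_trans (CD : repr C <= repr D) DE). Qed.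

HB.instance Definition _ := Order.Le_isPOrder.Build d poset_quot
  poset_quot_le_refl poset_quot_le_anti poset_quot_le_trans.

Lemma le_pi (x y : T) : (\pi_poset_quot x <= \pi_poset_quot y) = (x <= y).
Proof.
have equiv_repr z : order_equiv (repr (\pi_poset_quot z)) z.
  by rewrite -(eqquotE poset_quot) reprK.
have /andP[xr rx] := equiv_repr x; have /andP[yr ry] := equiv_repr y.
rewrite [LHS]/(repr (\pi_poset_quot x) <= repr (\pi_poset_quot y)).
apply/idP/idP => xy.
- exact: le_trans rx (le_trans xy yr).
- exact: le_trans xr (le_trans xy ry).
Qed.

End PosetQuotient.

Definition universal {d : Order.disp_t} (T : porderType d) : Prop :=
  countable [set: T] /\
  forall (d' : Order.disp_t) (U : porderType d'), countable [set: U] ->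
    exists f : U -> T, {mono f : x y / x <= y}.

(* The carrier is taken in [Set], and its structure stored as a class, because
   a record over all of [finPOrderType] would live in too large a universe to
   be a [choiceType], hence to be quotiented. No finite poset is lost, up to
   isomorphism: see [kposet_pack_iso] and [klattice_pack_iso] below. *)
Record kposet (k : nat) : Type := KPoset {
  kposet_disp : Order.disp_t;
  kposet_sort :> Set;
  kposet_class : Order.FinPOrder.axioms_ kposet_disp kposet_sort;
  kposet_label : kposet_sort -> 'I_k
}.

HB.instance Definition _ k (P : kposet k) := kposet_class P.

Definition kposet_hom k (P Q : kposet k) (h : P -> Q) : Prop :=
  {homo h : x y / x <= y} /\ forall x, kposet_label (h x) = kposet_label x.

HB.instance Definition _ k := gen_eqMixin (kposet k).
HB.instance Definition _ k := gen_choiceMixin (kposet k).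

Definition kposet_le k : rel (kposet k) :=
  fun P Q => `[< exists h : P -> Q, kposet_hom h >].

Lemma kposet_le_refl k : reflexive (@kposet_le k).
Proof. by move=> P; apply/asboolP; exists id; split. Qed.

Lemma kposet_le_trans k : transitive (@kposet_le k).
Proof.
move=> Q P S /asboolP[g [gle glab]] /asboolP[h [hle hlab]].
apply/asboolP; exists (h \o g); split=> [x y xy|x] /=.
- exact/hle/gle.
- by rewrite hlab glab.
Qed.

Fact kposet_display : Order.disp_t. Proof. exact: Order.Disp tt tt. Qed.

HB.instance Definition _ k := Order.Le_isPreorder.Build kposet_display (kposet k)
  (@kposet_le_refl k) (@kposet_le_trans k).

Record klattice (k : nat) : Type := KLattice {
  klattice_disp : Order.disp_t;
  klattice_sort : Set;
  klattice_class : Order.FinLattice.axioms_ klattice_disp klattice_sort;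
  klattice_label : klattice_sort -> 'I_k
}.

HB.instance Definition _ k (L : klattice k) := klattice_class L.

Definition kposet_of_klattice k (L : klattice k) : kposet k :=
  @KPoset k (klattice_disp L) (klattice_sort L)
    (Order.FinPOrder.class (klattice_sort L)) (@klattice_label k L).
Coercion kposet_of_klattice : klattice >-> kposet.

HB.instance Definition _ k := gen_eqMixin (klattice k).
HB.instance Definition _ k := gen_choiceMixin (klattice k).

(* Homomorphisms of k-lattices are those of k-posets: they need not preserve
   meets and joins. *)
Definition klattice_le k : rel (klattice k) :=
  fun L M => (L : kposet k) <= (M : kposet k).

Lemma klattice_le_refl k : reflexive (@klattice_le k).
Proof. by move=> L; rewrite /klattice_le lexx. Qed.

Lemma klattice_le_trans k : transitive (@klattice_le k).
Proof. by move=> M L N; exact: (@le_trans _ (kposet k)). Qed.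

HB.instance Definition _ k := Order.Le_isPreorder.Build kposet_display
  (klattice k) (@klattice_le_refl k) (@klattice_le_trans k).

Definition kposet_quot (k : nat) : porderType kposet_display :=
  poset_quot (kposet k).

Definition klattice_quot (k : nat) : porderType kposet_display :=
  poset_quot (klattice k).

Section SmallCopy.

Definition small_copy (T : finType) : Set := {i : nat | (i < #|T|)%N}.

Variable T : finType.

Definition of_small (i : small_copy T) : T := enum_val (Ordinal (valP i)).

Definition to_small (x : T) : small_copy T :=
  exist (fun i : nat => i < #|T|)%N _ (ltn_ord (enum_rank x)).

Lemma of_smallK : cancel of_small to_small.
Proof.
by move=> i; apply: val_inj; rewrite /to_small /of_small /= enum_valK.
Qed.

Lemma to_smallK : cancel to_small of_small.
Proof.
move=> x; rewrite -[RHS]enum_rankK /of_small; congr enum_val; exact: val_inj.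
Qed.

HB.instance Definition _ := Finite.copy (small_copy T) (can_type of_smallK).

End SmallCopy.

Section Pack.
Context (k : nat) {d : Order.disp_t}.

Section PackPoset.
Variable T : finPOrderType d.

Definition small_poset : Set := small_copy T.
HB.instance Definition _ := Finite.on small_poset.

HB.instance Definition _ :=
  Order.POrder.copy small_poset (can_type (@of_smallK T) : porderType d).

Definition kposet_pack (c : T -> 'I_k) : kposet k :=
  @KPoset k d small_poset (Order.FinPOrder.class small_poset)
    (fun i => c (of_small i)).

Lemma kposet_pack_iso (c : T -> 'I_k) :
  exists f : T -> kposet_pack c,
    [/\ bijective f, {mono f : x y / x <= y} &
        forall x, kposet_label (f x) = c x].
Proof.
exists (@to_small T); split.
- by exists (@of_small T); [exact: to_smallK | exact: of_smallK].
- by move=> x y; rewrite -{2}[x]to_smallK -{2}[y]to_smallK.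
- by move=> x; rewrite /= to_smallK.
Qed.

End PackPoset.

Section PackLattice.
Variable T : finLatticeType d.

Definition small_lattice : Set := small_poset T.
HB.instance Definition _ := Order.FinPOrder.on small_lattice.

Let of_small_lattice : small_lattice -> T := @of_small T.
Let to_small_lattice : T -> small_lattice := @to_small T.

Let of_small_latticeK : cancel of_small_lattice to_small_lattice.
Proof. exact: of_smallK. Qed.

Let to_small_latticeK : cancel to_small_lattice of_small_lattice.
Proof. exact: to_smallK. Qed.

Let of_small_lattice_mono : {mono of_small_lattice : x y / x <= y}.
Proof. by []. Qed.

HB.instance Definition _ := Order.IsoLattice.Build d small_lattice
  of_small_latticeK to_small_latticeK of_small_lattice_mono.

Definition klattice_pack (c : T -> 'I_k) : klattice k :=
  @KLattice k d small_lattice (Order.FinLattice.class small_lattice)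
    (fun i => c (of_small i)).

Lemma klattice_pack_iso (c : T -> 'I_k) :
  exists f : T -> klattice_pack c,
    [/\ bijective f, {mono f : x y / x <= y} &
        forall x, kposet_label (f x) = c x].
Proof. exact: kposet_pack_iso. Qed.

End PackLattice.
End Pack.

(* Main.v *)
Require Import Defs.
From mathcomp Require Import all_boot all_order.
From HB Require Import structures.
From mathcomp Require Import boolp classical_sets functions cardinality.

(* Let U be a countable poset with an injection e : U -> nat. Attach to s in U
   the squarefree number N(s), the product of the e(t)-th primes over the t >= s
   with e(t) <= e(s). Then N(t) divides N(s) iff s <= t and e(t) <= e(s), and
   with T(u) = {s <= u | e(s) <= e(u)} one has u <= v iff every N(s), s in T(u),
   is a multiple of some N(t), t in T(v): for s in T(u) take t = s if
   e(s) <= e(v) and t = v otherwise; conversely take s = u.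

   Divisibility means an equivariant map between disjoint unions of cycles. A
   self-map f : V -> V is encoded in a 2-poset made of two three-element chains
   per point v, one labelled 010 and one labelled 101; the first has its bottom
   below the top of the second, and the second has its bottom below the top of
   the first chain of f v. Alternating chains of length 3 must be preserved by
   homomorphisms, which are thus exactly the equivariant maps. If f is injective
   without fixed points, two incomparable elements have at most one common upper
   bound and at most one common lower bound, so adding a bottom and a top with a
   third label yields a 3-lattice with the same homomorphisms. *)

Set Implicit Arguments.
Unset Strict Implicit.
Unset Printing Implicit Defensive.

Import Order.TTheory.

(** * Squarefree codes of a relation on the natural numbers *)

(** Each term is a prime above the previous one, possibly not the next prime. *)
Fixpoint prime_seq (n : nat) : nat :=
  if n is m.+1 then s2val (prime_above (prime_seq m)) else 2.

Lemma prime_seq_prime n : prime (prime_seq n).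
Proof. by case: n => //= n; case: prime_above. Qed.

Lemma prime_seq_inj : injective prime_seq.
Proof.
apply/incn_inj/leq_mono/(homo_ltn ltn_trans) => n.
by rewrite /=; case: prime_above.
Qed.

Section RelationCode.
Variable R : rel nat.

(** Only indices up to [i] enter, which keeps the product finite. *)
Definition rel_code (i : nat) : nat := \prod_(0 <= j < i.+1 | R i j) prime_seq j.

Lemma rel_code_gt0 i : 0 < rel_code i.
Proof. by apply: prodn_cond_gt0 => j _; exact/prime_gt0/prime_seq_prime. Qed.

Lemma dvdn_prime_rel_code i j : (prime_seq j %| rel_code i) = (j <= i) && R i j.
Proof.
rewrite /rel_code big_mkord Euclid_dvd_prod ?prime_seq_prime //.
rewrite big_has_cond; apply/hasP/andP => [[l _ /andP[Ril]]|[ji Rij]].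
  rewrite dvdn_prime2 ?prime_seq_prime // => /eqP/prime_seq_inj ->.
  by rewrite -ltnS.
by exists (Ordinal (ji : j < i.+1)); rewrite ?mem_index_enum //= Rij dvdnn.
Qed.

Lemma rel_code_gt1 i : R i i -> 1 < rel_code i.
Proof.
move=> Rii; apply: (leq_trans (prime_gt1 (prime_seq_prime i))).
by rewrite dvdn_leq ?rel_code_gt0 // dvdn_prime_rel_code leqnn.
Qed.

(** By [R j j], the prime of index [j] is a factor of [rel_code j], which gives one direction.
    Conversely, transitivity makes every prime factor of [rel_code j] a factor of [rel_code i]. *)
Lemma dvdn_rel_code i j : transitive R -> R j j ->
  (rel_code j %| rel_code i) = (j <= i) && R i j.
Proof.
move=> Rtr Rjj; rewrite -dvdn_prime_rel_code; apply/idP/idP => [|ji].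
  by apply: dvdn_trans; rewrite dvdn_prime_rel_code leqnn.
move: ji; rewrite dvdn_prime_rel_code => /andP[ji Rij].
rewrite {2}/rel_code (big_cat_nat (n := j.+1)) //=; apply: dvdn_mulr.
rewrite /rel_code big_mkcond [X in _ %| X]big_mkcond.
apply: (big_ind2 dvdn) => // [? ? ? ?|l _]; first exact: dvdn_mul.
by case: ifP => [/(Rtr _ _ _ Rij) ->|_] //; exact: dvd1n.
Qed.

End RelationCode.

(** * Disjoint unions of cycles and divisibility *)

Section Cycles.
Variables (T : finType) (N : T -> nat).

Definition cycles : finType := {x : T & 'I_(N x)}.

Definition rotate (v : cycles) : cycles :=
  Tagged (fun x => 'I_(N x)) (ordS (tagged v)).

Lemma cycles_eq (u v : cycles) :
  tag u = tag v -> tagged u = tagged v :> nat -> u = v.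
Proof. by case: u v => [x i] [y j] /= xy; subst y => /val_inj ->. Qed.

Lemma rotate_inj : injective rotate.
Proof.
move=> [x i] [y j] /= e; have /= xy := congr1 tag e; subst y.
by move/eqP: e; rewrite eq_Tagged /= => /eqP/ordS_inj ->.
Qed.

Lemma tag_iter_rotate m v : tag (iter m rotate v) = tag v.
Proof. by elim: m => //= m ->. Qed.

Lemma tagged_iter_rotate m v :
  tagged (iter m rotate v) = (tagged v + m) %% N (tag v) :> nat.
Proof.
elim: m => [|m IH] /=; first by rewrite addn0 modn_small.
by rewrite IH tag_iter_rotate addnS -addn1 modnDml addn1.
Qed.

(** Every point of the cycle over [x] has exact period [N x]; this is how divisibility enters. *)
Lemma iter_rotate_fix m v : (iter m rotate v == v) = (N (tag v) %| m).
Proof.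
apply/eqP/idP => [/(congr1 (fun u : cycles => tagged u : nat))|/eqP Nm].
  rewrite tagged_iter_rotate => /eqP.
  by rewrite -[X in _ == X](modn_small (ltn_ord (tagged v)))
    -{2}[tagged v : nat]addn0 eqn_modDl mod0n.
apply: cycles_eq; rewrite ?tag_iter_rotate // tagged_iter_rotate.
by rewrite -modnDmr Nm addn0 modn_small.
Qed.

Lemma rotate_neq v : 1 < N (tag v) -> rotate v != v.
Proof.
by rewrite -[rotate v]/(iter 1 rotate v) iter_rotate_fix dvdn1; case: ltngtP.
Qed.

End Cycles.

(** The period of an image divides the period of its source. Conversely, reduction modulo [M y] is
    equivariant once [M y] divides [N x]. *)
Lemma cycles_equivariantP (T T' : finType) (N : T -> nat) (M : T' -> nat) :
  (forall x, 0 < N x) -> (forall y, 0 < M y) ->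
  (exists s : cycles N -> cycles M, forall v, s (rotate v) = rotate (s v)) <->
  (forall x, exists y, M y %| N x).
Proof.
move=> N_gt0 M_gt0; split=> [[s sE] x|H].
  pose v : cycles N := Tagged (fun x => 'I_(N x)) (Ordinal (N_gt0 x)).
  exists (tag (s v)); rewrite -iter_rotate_fix.
  have sI m : iter m (@rotate _ M) (s v) = s (iter m (@rotate _ N) v).
    by elim: m => //= m ->; rewrite sE.
  by rewrite sI; have /eqP-> : iter (N x) (@rotate _ N) v == v
    by rewrite iter_rotate_fix.
have [y yP] := choice H.
exists (fun v : cycles N => Tagged (fun x => 'I_(M x))
  (Ordinal (ltn_pmod (nat_of_ord (tagged v)) (M_gt0 (y (tag v))))) : cycles M).
move=> v; apply: cycles_eq => //=.
by rewrite modn_dvdm // -addn1 -modnDml addn1.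
Qed.

(** * Comparison of packed structures on their original carriers *)

Lemma kposet_pack_leP k d d' (P : finPOrderType d) (Q : finPOrderType d')
    (c : P -> 'I_k) (c' : Q -> 'I_k) :
  reflect (exists2 h : P -> Q, {homo h : x y / (x <= y)%O} &
             forall x, c' (h x) = c x)
    (kposet_pack c <= kposet_pack c')%O.
Proof.
apply: (iffP (asboolP _)) => [[h [hle hlab]]|[h hle hlab]].
- exists (fun x => of_small (h (to_small x))) => [x y xy|x].
  + by apply: hle; rewrite -[x]to_smallK -[y]to_smallK in xy.
  + by rewrite -[RHS](congr1 c (to_smallK x)); exact: hlab.
- exists (fun x => to_small (h (of_small x))); split=> [x y xy|x].
  + have := hle _ _ xy.
    by rewrite -{1}[h (of_small x)]to_smallK -{1}[h (of_small y)]to_smallK.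
  + by rewrite /= to_smallK; exact: hlab.
Qed.

Lemma klattice_pack_leP k d d' (P : finLatticeType d) (Q : finLatticeType d')
    (c : P -> 'I_k) (c' : Q -> 'I_k) :
  reflect (exists2 h : P -> Q, {homo h : x y / (x <= y)%O} &
             forall x, c' (h x) = c x)
    (klattice_pack c <= klattice_pack c')%O.
Proof. exact: kposet_pack_leP. Qed.

(** * Countability of the quotients *)

Section Code.
Variable k : nat.

Definition kposet_code : countType :=
  {n : nat & ({ffun 'I_n * 'I_n -> bool} * {ffun 'I_n -> 'I_k})%type}.

Definition coded_by (C : kposet_code) (P : kposet k) : Prop :=
  exists f : 'I_(tag C) -> P, [/\ bijective f,
    forall i j, (f i <= f j)%O = (tagged C).1 (i, j) &
    forall i, kposet_label (f i) = (tagged C).2 i].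

Lemma kposet_codeP (P : kposet k) : exists C, coded_by C P.
Proof.
exists (Tagged (fun n => ({ffun 'I_n * 'I_n -> bool} * {ffun 'I_n -> 'I_k})%type)
  ([ffun p : 'I_#|{: P}| * 'I_#|{: P}| => (enum_val p.1 <= enum_val p.2 :> P)%O],
   [ffun i : 'I_#|{: P}| => kposet_label (enum_val i : P)])).
exists (fun i => enum_val i); split => [|i j|i] /=; last 2 first.
- by rewrite ffunE.
- by rewrite ffunE.
exact: enum_val_bij.
Qed.

Lemma coded_by_le (C : kposet_code) (P Q : kposet k) :
  coded_by C P -> coded_by C Q -> (P <= Q)%O.
Proof.
move=> [f [[f' fK f'K] fle flab]] [g [_ gle glab]].
apply/asboolP; exists (fun x => g (f' x)); split=> [x y xy|x].
  by rewrite gle -fle !f'K.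
by rewrite glab -flab f'K.
Qed.

End Code.

(** Elements sharing a code are equivalent, so coding the chosen representatives is injective on
    classes. *)
Lemma countable_poset_quot d (T : preorderType d) (C : countType) (r : C -> T -> Prop) :
  (forall x, exists c, r c x) ->
  (forall c x y, r c x -> r c y -> (x <= y)%O) ->
  countable [set: poset_quot T].
Proof.
move=> /choice[code codeP] r_le; apply/countable_injP.
exists (fun X => pickle (code (repr X))) => X Y _ _ /(pcan_inj pickleK) e.
rewrite -[X]reprK -[Y]reprK; apply/eqP; rewrite eqquotE.
have X_code := codeP (repr X); have Y_code := codeP (repr Y).
rewrite e in X_code; apply/andP.
by split; [exact: r_le X_code Y_code | exact: r_le Y_code X_code].
Qed.

Lemma countable_kposet_quot k : countable [set: kposet_quot k].
Proof.
exact: (countable_poset_quot (@kposet_codeP k) (@coded_by_le k)).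
Qed.

Lemma countable_klattice_quot k : countable [set: klattice_quot k].
Proof.
apply: (@countable_poset_quot _ _ _ (fun C (L : klattice k) => coded_by C L)).
  by move=> L; exact: kposet_codeP.
by move=> C L M; exact: coded_by_le.
Qed.

(** * The 2-poset of a self-map *)

(* [f] is a phantom argument from which the order below is inferred. In
   [(v, (c, i))], [c] selects the chain 010 or 101 at [v], and [i] the level. *)
Definition spindle (V : finType) (f : V -> V) : Type := (V * (bool * 'I_3))%type.

Section Spindle.
Variables (V : finType) (f : V -> V).
Local Notation spindle := (spindle f).

HB.instance Definition _ := Finite.on spindle.

(** The links for the two values of [c], composed in either order, give [f]. *)
Definition spindle_link (c : bool) (v : V) : V := if c then f v else v.

Definition spindle_le : rel spindle := fun p q =>
  let: (v, (c, i)) := p in let: (w, (d, j)) := q in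
  if c == d then (v == w) && (i <= j)
  else [&& w == spindle_link c v, i == 0 :> nat & j == 2 :> nat].

Lemma spindle_le_refl : reflexive spindle_le.
Proof. by move=> [v [c i]] /=; rewrite !eqxx leqnn. Qed.

Lemma spindle_le_anti : antisymmetric spindle_le.
Proof.
move=> [v [c i]] [w [d j]] /= /andP[]; case: (eqVneq c d) => [<-|_] /=.
  move=> /andP[/eqP<- ij] /andP[_ ji].
  by congr (_, (_, _)); apply/val_inj/eqP; rewrite eqn_leq ij.
by move=> /and3P[_ /eqP i0 /eqP j2]; rewrite j2 andbF.
Qed.

Lemma spindle_le_trans : transitive spindle_le.
Proof.
move=> [w [d j]] [v [c i]] [u [e l]] /=.
case: (eqVneq c d) => [<-|cd] /=.
  move=> /andP[/eqP<- ij]; case: ifP => _ /andP[->] /=; first exact: leq_trans.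
  by case/andP => /eqP j0 ->; move: ij; rewrite j0 leqn0 => ->.
move=> /and3P[/eqP-> /eqP-> /eqP->].
case: (eqVneq d e) => [<-|_] /=; last by rewrite andbF.
rewrite (negbTE cd) => /andP[/eqP<- l2]; rewrite eqxx /= eqn_leq.
by rewrite l2 -ltnS ltn_ord.
Qed.

Fact spindle_display : Order.disp_t. Proof. exact: Order.Disp tt tt. Qed.

HB.instance Definition _ := Order.Le_isPOrder.Build spindle_display spindle
  spindle_le_refl spindle_le_anti spindle_le_trans.

Lemma spindle_leE v c i w d j : (((v, (c, i)) : spindle) <= (w, (d, j)))%O =
  if c == d then (v == w) && (i <= j)
  else [&& w == spindle_link c v, i == 0 :> nat & j == 2 :> nat].
Proof. by []. Qed.

Definition spindle_label (p : spindle) : bool := p.2.1 (+) odd p.2.2.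

(** The labels make both steps strict. A link runs from a minimal to a maximal element, so it cannot
    be one of two consecutive strict steps; the three points therefore exhaust one chain. *)
Lemma spindle_alternating (p q r : spindle) :
  (p <= q)%O -> (q <= r)%O ->
  spindle_label q = ~~ spindle_label p -> spindle_label r = spindle_label p ->
  forall i : 'I_3, nth p [:: p; q; r] i = (p.1, (spindle_label p, i)).
Proof.
case: p q r => [v [c i]] [w [d j]] [u [e l]]; rewrite !spindle_leE /spindle_label /=.
move: i j l => [[|[|[|//]]] ?] [[|[|[|//]]] ?] [[|[|[|//]]] ?];
  rewrite ?andbF ?if_same //=; case: c d => [] [] //=; case: e => //=;
  rewrite ?andbF ?andbT // => /eqP-> /eqP-> _ _ [[|[|[|//]]] ?] /=;
  congr (_, (_, _)); exact: val_inj.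
Qed.

Lemma spindle_chain (c : bool) (p : 'I_3 -> spindle) :
  (forall i j : 'I_3, i <= j -> (p i <= p j)%O) ->
  (forall i, spindle_label (p i) = c (+) odd i) ->
  forall i, p i = ((p ord0).1, (c, i)).
Proof.
move=> p_le p_lab i; pose one : 'I_3 := inord 1.
have -> : p i = nth (p ord0) [:: p ord0; p one; p ord_max] i.
  by case: i => [[|[|[|//]]] ?] /=; congr p; apply: val_inj; rewrite /= ?inordK.
by rewrite spindle_alternating ?p_le ?p_lab ?inordK //= ?addbT ?addbF //.
Qed.

Hypotheses (f_inj : injective f) (f_fixfree : forall v, f v != v).

Lemma spindle_link_inj c : injective (spindle_link c).
Proof. by case: c => // v w; exact: f_inj. Qed.

Lemma spindle_linkN c v : (v == spindle_link c (spindle_link (~~ c) v)) = false.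
Proof. by case: c => /=; rewrite eq_sym (negbTE (f_fixfree v)). Qed.

(** Two upper bounds on chains of the same kind are both the top of one chain. If the kinds differ,
    following the links leads back to the start and gives a fixed point of [f]. *)
Lemma spindle_no_square c v w (e e' : bool) u u' (i j l l' : 'I_3) :
  (((v, (c, i)) : spindle) <= (u, (e, l)))%O ->
  (((w, (~~ c, j)) : spindle) <= (u, (e, l)))%O ->
  (((v, (c, i)) : spindle) <= (u', (e', l')))%O ->
  (((w, (~~ c, j)) : spindle) <= (u', (e', l')))%O ->
  (u, (e, l)) = (u', (e', l')).
Proof.
have eqN b : (b == ~~ b) = false by case: b.
have eqN' b : (~~ b == b) = false by case: b.
have eqB b : b = c \/ b = ~~ c by case: b c => [] []; tauto.
rewrite !spindle_leE.
case: (eqB e) (eqB e') => -> [] ->; rewrite ?eqxx ?eqN ?eqN' ?negbK.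
- move=> /andP[/eqP-> _] /and3P[_ _ /eqP l2] /andP[/eqP-> _] /and3P[_ _ /eqP l2'].
  by congr (_, (_, _)); apply: val_inj; rewrite /= l2 l2'.
- move=> /andP[/eqP<- _] /and3P[/eqP-> _ _] /and3P[uE _ _] /andP[/eqP wu _].
  by rewrite -wu spindle_linkN in uE.
- move=> /and3P[/eqP-> _ _] /andP[/eqP-> _] /andP[/eqP<- _] /and3P[+ _ _].
  by have := spindle_linkN (~~ c) v; rewrite negbK => ->.
- move=> /and3P[_ _ /eqP l2] /andP[/eqP-> _] /and3P[_ _ /eqP l2'] /andP[/eqP-> _].
  by congr (_, (_, _)); apply: val_inj; rewrite /= l2 l2'.
Qed.

(** When [x] and [y] lie on chains of the same kind, either both are on the chain of [z], hence
    comparable, or both are linked to [z], hence equal because links are injective. *)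
Lemma spindle_join_cond (x y z t : spindle) :
  (x <= z)%O -> (y <= z)%O -> (x <= t)%O -> (y <= t)%O ->
  [|| (x <= y)%O, (y <= x)%O | z == t].
Proof.
case: x y z t => [v [c i]] [w [d j]] [u [e l]] [u' [e' l']].
case: (eqVneq c d) => [<-|cd]; last first.
  have -> : d = ~~ c by case: c d cd => [] [].
  by move=> xz yz xt yt; rewrite (spindle_no_square xz yz xt yt) eqxx !orbT.
rewrite !spindle_leE eqxx.
case: (eqVneq c e) => [_ /andP[/eqP-> _] /andP[/eqP-> _] _ _|_].
  by rewrite eqxx /= orbA leq_total.
move=> /and3P[/eqP-> /eqP-> _] /and3P[/eqP/spindle_link_inj-> /eqP-> _] _ _.
by rewrite eqxx.
Qed.

Lemma spindle_meet_cond (x y z t : spindle) :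
  (x <= z)%O -> (y <= z)%O -> (x <= t)%O -> (y <= t)%O ->
  [|| (z <= t)%O, (t <= z)%O | x == y].
Proof.
case: x y z t => [v [c i]] [w [d j]] [u [e l]] [u' [e' l']].
case: (eqVneq c d) => [<-|cd]; last first.
  have -> : d = ~~ c by case: c d cd => [] [].
  by move=> xz yz xt yt; rewrite (spindle_no_square xz yz xt yt) lexx.
rewrite !spindle_leE; case: (eqVneq c e) => [<-|ce].
  move=> /andP[/eqP<- _] /andP[/eqP-> _]; case: (eqVneq c e') => _.
    by move=> /andP[/eqP-> _] _; rewrite eqxx /= orbA leq_total.
  move=> /and3P[_ /eqP i0 _] /and3P[_ /eqP j0 _].
  by apply/or3P/Or33; have /val_inj-> : i = j :> nat by rewrite i0.
move=> /and3P[/eqP-> /eqP i0 /eqP->] /and3P[/eqP/spindle_link_inj-> /eqP j0 _].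
by move=> _ _; apply/or3P/Or33; have /val_inj-> : i = j :> nat by rewrite i0.
Qed.

End Spindle.

Lemma spindle_homP (V W : finType) (f : V -> V) (g : W -> W) :
  (exists2 h : spindle f -> spindle g, {homo h : x y / (x <= y)%O} &
     forall x, spindle_label (h x) = spindle_label x) <->
  exists s : V -> W, forall v, s (f v) = g (s v).
Proof.
split=> [[h hle hlab]|[s sE]]; last first.
  exists (fun p => (s p.1, p.2)) => [[v [c i]] [w [d j]]|[v [c i]]] //.
  rewrite !spindle_leE; case: ifP => [_ /andP[/eqP->]|_ /and3P[/eqP-> -> ->]].
    by rewrite eqxx.
  by rewrite !andbT; case: c => //=; rewrite sE.
pose s c v := (h (v, (c, ord0))).1.
have hE v c i : h (v, (c, i)) = (s c v, (c, i)).
  apply: (spindle_chain (p := fun i => h (v, (c, i)))) => [j l jl|j].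
    by apply: hle; rewrite spindle_leE !eqxx.
  by rewrite hlab.
exists (s false) => v.
(* With [c] false, both chains at [u] land over the same point; with [c] true, the link across [f]
   becomes a link across [g]. *)
have link c u : s (~~ c) (spindle_link f c u) = spindle_link g c (s c u).
  have : (((u, (c, ord0)) : spindle f) <= (spindle_link f c u, (~~ c, ord_max)))%O.
    by rewrite spindle_leE eqxx; case: (c).
  by move=> /hle; rewrite !hE spindle_leE; case: (c) => /= /andP[/eqP].
exact: etrans (link true v) (congr1 g (link false v)).
Qed.

(** * Completion to a lattice by a bottom [inr false] and a top [inr true] *)

Section Capped.
Context {d : Order.disp_t} (P : finPOrderType d).

Definition capped : Type := (P + bool)%type.
HB.instance Definition _ := Finite.on capped.

Definition capped_le : rel capped := fun x y =>
  match x, y with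
  | inl p, inl q => (p <= q)%O
  | inr b, inl _ => ~~ b
  | inl _, inr b => b
  | inr b, inr b' => b ==> b'
  end.

Lemma capped_le_refl : reflexive capped_le.
Proof. by move=> [p|b] /=; rewrite ?lexx ?implybb. Qed.

Lemma capped_le_anti : antisymmetric capped_le.
Proof. by move=> [p|[]] [q|[]] //= /le_anti ->. Qed.

Lemma capped_le_trans : transitive capped_le.
Proof. move=> [p|[]] [q|[]] [r|[]] //=; exact: le_trans. Qed.

HB.instance Definition _ := Order.Le_isPOrder.Build d capped
  capped_le_refl capped_le_anti capped_le_trans.

Hypothesis join_cond : forall x y z t : P,
  (x <= z)%O -> (y <= z)%O -> (x <= t)%O -> (y <= t)%O ->
  [|| (x <= y)%O, (y <= x)%O | z == t].

Hypothesis meet_cond : forall x y z t : P,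
  (x <= z)%O -> (y <= z)%O -> (x <= t)%O -> (y <= t)%O ->
  [|| (z <= t)%O, (t <= z)%O | x == y].

(** Incomparable elements both come from [P]; their join is their common upper bound in [P], unique
    by [join_cond], or the new top if there is none. *)
Lemma capped_has_join (x y : capped) :
  exists z : capped, forall t : capped, (z <= t)%O = (x <= t)%O && (y <= t)%O.
Proof.
have [xy|xy] := boolP (x <= y)%O.
  by exists y => t; apply/idP/andP => [yt|[]//]; split=> //; exact: le_trans yt.
have [yx|yx] := boolP (y <= x)%O.
  by exists x => t; apply/idP/andP => [xt|[]//]; split=> //; exact: le_trans xt.
case: x y xy yx => [p|[]] [q|[]] // /negP pq /negP qp.
have [z /andP[pz qz]|noub] := pickP (fun z => (p <= z) && (q <= z))%O.
  exists (inl z) => t; apply/idP/andP => [zt|[]].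
    by split; apply: le_trans zt.
  case: t => [t|[]] // pt qt.
  by case/or3P: (join_cond pz qz pt qt) => // /eqP->.
by exists (inr true) => -[t|[]] //; apply/esym/noub.
Qed.

Lemma capped_has_meet (x y : capped) :
  exists z : capped, forall t : capped, (t <= z)%O = (t <= x)%O && (t <= y)%O.
Proof.
have [xy|xy] := boolP (x <= y)%O.
  by exists x => t; apply/idP/andP => [tx|[]//]; split=> //; exact: le_trans xy.
have [yx|yx] := boolP (y <= x)%O.
  by exists y => t; apply/idP/andP => [ty|[]//]; split=> //; exact: le_trans yx.
case: x y xy yx => [p|[]] [q|[]] // /negP pq /negP qp.
have [z /andP[zp zq]|nolb] := pickP (fun z => (z <= p) && (z <= q))%O.
  exists (inl z) => t; apply/idP/andP => [tz|[]].
    by split; apply: le_trans tz _.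
  case: t => [t|[]] // tp tq.
  by case/or3P: (meet_cond zp tp zq tq) => // /eqP->.
by exists (inr false) => -[t|[]] //; apply/esym/nolb.
Qed.

Definition capped_lattice : finLatticeType d :=
  let join x y := projT1 (cid (capped_has_join x y)) in
  let meet x y := projT1 (cid (capped_has_meet x y)) in
  HB.pack capped (Order.POrder_MeetJoin_isLattice.Build d capped
    (meet := meet) (join := join)
    (fun x y z => projT2 (cid (capped_has_meet y z)) x)
    (fun x y => projT2 (cid (capped_has_join x y)))).

End Capped.

(** * Countable orders from divisibility *)

(** The bound [1 < N u x] makes the rotations fixed-point-free, as the lattice encoding requires. *)
Lemma countable_order_divisibility d (U : porderType d) :
  countable [set: U] ->
  exists (T : U -> finType) (N : forall u, T u -> nat),
    (forall u x, 1 < N u x) /\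
    forall u v, (u <= v)%O <-> forall x : T u, exists y : T v, N v y %| N u x.
Proof.
move=> /countable_injP[e e_inj'].
have e_inj : injective e by move=> u v; apply: e_inj'; rewrite in_setE.
(* The order of [U] transported along [e], empty off the image of [e]. *)
pose R i j := `[< exists s t, [/\ e s = i, e t = j & (s <= t)%O] >].
have RE s t : R (e s) (e t) = (s <= t)%O.
  apply/asboolP/idP => [[s' [t' [/e_inj<- /e_inj<-]]]//|st].
  by exists s, t.
have Rr i j : R i j -> exists s, i = e s.
  by move=> /asboolP[s [t [<- _ _]]]; exists s.
have Rtr : transitive R.
  move=> _ _ _ /asboolP[s [t [<- <- st]]] /asboolP[t' [r [/e_inj-> <- tr]]].
  by rewrite RE; exact: le_trans tr.
have Rxx s : R (e s) (e s) by rewrite RE.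
pose T u : finType := {i : 'I_(e u).+1 | R i (e u)}.
pose inT u i (iu : i < (e u).+1) (Riu : R i (e u)) : T u := exist _ (Ordinal iu) Riu.
exists T, (fun u x => rel_code R (val (val x))); split=> [u [i /= /Rr[s ->]]|u v].
  exact: rel_code_gt1.
split=> [uv [i iu]|H].
  have [s sE] := Rr _ _ iu; rewrite /= in sE *.
  have su : (s <= u)%O by rewrite -RE -sE.
  have sv := le_trans su uv.
  have [i_le|v_lt] := leqP i (e v).
    have iv : R i (e v) by rewrite sE RE.
    by exists (inT v i i_le iv).
  exists (inT v _ (ltnSn _) (Rxx v)).
  by rewrite /= dvdn_rel_code // (ltnW v_lt) /= sE RE.
have [[j jv] /=] := H (inT u _ (ltnSn _) (Rxx u)).
have [t tE] := Rr _ _ jv; rewrite tE dvdn_rel_code // => /andP[_ ut].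
by rewrite -RE; apply: Rtr ut _; rewrite -tE.
Qed.

(** * Labelled encodings and universality *)

Section Labels.
Variable k : nat.

Definition bool_label (k_gt1 : 1 < k) (b : bool) : 'I_k :=
  Ordinal (leq_ltn_trans (leq_b1 b) k_gt1).

Lemma bool_label_inj (k_gt1 : 1 < k) : injective (bool_label k_gt1).
Proof. by case=> [] [] // /(congr1 val). Qed.

Definition spindle_kposet (k_gt1 : 1 < k) (V : finType) (f : V -> V) : kposet k :=
  kposet_pack (fun p : spindle f => bool_label k_gt1 (spindle_label p)).

Lemma spindle_kposet_leP (k_gt1 : 1 < k) (V W : finType) (f : V -> V) (g : W -> W) :
  (spindle_kposet k_gt1 f <= spindle_kposet k_gt1 g)%O <->
  exists s : V -> W, forall v, s (f v) = g (s v).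
Proof.
rewrite -spindle_homP; split=> [/kposet_pack_leP|] [h hle hlab].
  by exists h => // x; apply: (@bool_label_inj k_gt1); exact: hlab.
by apply/kposet_pack_leP; exists h => // x; rewrite hlab.
Qed.

Definition capped_label (k_gt2 : 2 < k) (V : finType) (f : V -> V)
    (x : capped (spindle f)) : 'I_k :=
  match x with
  | inl p => bool_label (ltnW k_gt2) (spindle_label p)
  | inr _ => Ordinal k_gt2
  end.

Definition spindle_klattice (k_gt2 : 2 < k) (V : finType) (f : V -> V)
    (f_inj : injective f) (f_fixfree : forall v, f v != v) : klattice k :=
  @klattice_pack k _ (capped_lattice (spindle_join_cond f_inj f_fixfree)
    (spindle_meet_cond f_inj f_fixfree)) (@capped_label k_gt2 V f).

Lemma spindle_klattice_leP (k_gt2 : 2 < k) (V W : finType) (f : V -> V)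
    (g : W -> W) (f_inj : injective f) (f_fixfree : forall v, f v != v)
    (g_inj : injective g) (g_fixfree : forall v, g v != v) :
  (spindle_klattice k_gt2 f_inj f_fixfree <=
    spindle_klattice k_gt2 g_inj g_fixfree)%O <->
  exists s : V -> W, forall v, s (f v) = g (s v).
Proof.
rewrite -spindle_homP; split=> [/klattice_pack_leP|] [h hle hlab].
  (* The third label occurs only on the added bottom and top, so [h] maps spindle to spindle. *)
  have hP p : exists q : spindle g, h (inl p) = inl q.
    have := hlab (inl p); case: (h (inl p)) => [q _|b /(congr1 val)/=]; first by exists q.
    by case: spindle_label.
  have [h' h'E] := choice hP; exists h' => [p q pq|p].
    by have := hle (inl p) (inl q) pq; rewrite !h'E.
  by have := hlab (inl p); rewrite h'E => /bool_label_inj.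
apply/klattice_pack_leP.
exists (fun x => match x with inl p => inl (h p) | inr b => inr b end).
  by move=> [p|b] [q|b'] //; exact: hle.
by move=> [p|b] //=; rewrite hlab.
Qed.

End Labels.

Lemma universal_poset_quot d (T : preorderType d) :
  countable [set: poset_quot T] ->
  (forall d' (U : porderType d'), countable [set: U] ->
    exists f : U -> T, {mono f : x y / (x <= y)%O}) ->
  universal (poset_quot T).
Proof.
move=> T_count T_emb; split=> // d' U /T_emb[f f_mono].
by exists (fun u => \pi_(poset_quot T)%qT (f u)) => u v; rewrite le_pi f_mono.
Qed.

Theorem theorem3p5 :
  (forall k : nat, 2 <= k -> universal (kposet_quot k)) /\
  (forall k : nat, 3 <= k -> universal (klattice_quot k)).
Proof.
split=> k k_gt.
- apply: universal_poset_quot => [|d U]; first exact: countable_kposet_quot.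
  move=> /countable_order_divisibility[T [N [N_gt1 N_le]]].
  exists (fun u => spindle_kposet k_gt (@rotate _ (N u))) => u v.
  have N_gt0 u' x := ltnW (N_gt1 u' x).
  by apply/idP/idP; rewrite spindle_kposet_leP N_le
    (cycles_equivariantP (N_gt0 u) (N_gt0 v)).
- apply: universal_poset_quot => [|d U]; first exact: countable_klattice_quot.
  move=> /countable_order_divisibility[T [N [N_gt1 N_le]]].
  exists (fun u => spindle_klattice k_gt (@rotate_inj _ (N u))
    (fun v => rotate_neq (N_gt1 u (tag v)))) => u v.
  have N_gt0 u' x := ltnW (N_gt1 u' x).
  by apply/idP/idP; rewrite spindle_klattice_leP N_le
    (cycles_equivariantP (N_gt0 u) (N_gt0 v)).
Qed.
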